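(* The functors $\mathcal O$, $\mathcal O_h$, $\mathcal O_l$ and $\mathcal O_{l,h}$ are epimorphic. That is, for a fixed $K$ in $Ob(\mathcal K_w)$ (respectively $Ob(\mathcal K_{w,l})$, $Ob(\mathcal K)$, $Ob(\mathcal K_l)$), each of them sends every epimorphism $f:X\to Y$ of sets (of linearly ordered sets with non-decreasing maps, in the cases $\mathcal O_l$ and $\mathcal O_{l,h}$) to a surjective map $\mathcal O(f):\mathcal O(X,K)\to\mathcal O(Y,K)$ (respectively $\mathcal O_h(f)$, $\mathcal O_l(f)$, $\mathcal O_{l,h}(f)$).
   Context: Quasirings. A quasiring is a set $K$ with operations $+,\times$ such that $K$ under $+$ and $K\setminus\{0\}$ under $\times$ are groupoids (sets with a binary operation) with neutral elements $0$ and $1$, $a0=0a=0$ for all $a$, and left distributivity $a(b+c)=ab+ac$ or right distributivity $(b+c)a=ba+ca$ holds (no associativity or commutativity is required). Orders. A set is directed by $\le$ if $\le$ is transitive, reflexive and any two elements have a common upper bound; $x<y$ means $x\le y$, $x\ne y$. Linearly ordered: $<$ is transitive, asymmetric, and any two distinct elements are comparable. Well-ordered: linearly ordered and each non-void subset has a least element. An ordered quasiring has order-preserving operations: $a+b\le c+d$ and $ab\le cd$ whenever $a\le c$, $b\le d$ and $a,b,c,d$ lie in a common linearly ordered subset; its minimal element is $0$. Condition (DW): every linearly ordered subset is contained in a well-ordered subset. $\mathcal K$ is the category of directed quasirings satisfying (DW), with order-preserving algebraic homomorphisms; $\mathcal K_w$ is its subcategory of well-ordered quasirings; $\mathcal K_l$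 and $\mathcal K_{w,l}$ are the subcategories of left distributive quasirings in $\mathcal K$ and $\mathcal K_w$. Function spaces. $C(X,K)$ is the set of all maps $X\to K$ with pointwise operations and order; for linearly ordered $X$, $C_+(X,K)$ is the set of monotone non-decreasing maps. It is a standing assumption that $\sup f(X)$ exists in $K$ for every $f$ in $C(X,K)$ (resp. $C_+(X,K)$). $g^c$ denotes the constant map with value $c\in K$. Functionals. $\nu:C(X,K)\to K$ is order preserving if $f\le h$ implies $\nu(f)\le\nu(h)$; weakly additive if $\nu(h+g^c)=\nu(h)+c$ and $\nu(g^c+h)=c+\nu(h)$; left homogeneous if $\nu(bf)=b\,\nu(f)$ for $b\in K$; similarly on $C_+(X,K)$. $\mathcal O(X,K)$ (resp. $\mathcal O_l(X,K)$) is the set of order preserving weakly additive functionals on $C(X,K)$ (resp. $C_+(X,K)$); $\mathcal O_h(X,K)$, $\mathcal O_{l,h}(X,K)$ are their subsets of left homogeneous functionals. For $f:X\to Y$ (non-decreasing in the cases with index $l$), $(\mathcal O(f)(\nu))(g)=\nu(g\circ f)$ for $g\in C(Y,K)$ (resp. $C_+(Y,K)$), and likewise for $\mathcal O_h,\mathcal O_l,\mathcal O_{l,h}$. $\mathcal O,\mathcal O_h$ are functors on the category of sets; $\mathcal O_l,\mathcal O_{l,h}$ on the category of linearly ordered sets and non-decreasing maps. A covariant functor is epimorphic if it preserves epimorphisms. *)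

(* Defs.v *)
From mathcomp Require Import all_boot all_order.
From mathcomp Require Import boolp classical_sets functions.

Set Implicit Arguments.
Unset Strict Implicit.
Unset Printing Implicit Defensive.

Local Open Scope classical_set_scope.

(* The order of a quasiring is only assumed transitive, reflexive and directed;
   it need not be antisymmetric, so x < y is "x <= y and x <> y" and not the
   strict part of a mathcomp preorder. *)
Section Relations.
Variables (T : Type) (le : T -> T -> Prop).

Definition strict (x y : T) : Prop := le x y /\ x <> y.

Definition linearly_ordered (A : set T) : Prop :=
  [/\ forall x y z, A x -> A y -> A z ->
        strict x y -> strict y z -> strict x z,
      forall x y, A x -> A y -> strict x y -> ~ strict y x
    & forall x y, A x -> A y -> x <> y -> strict x y \/ strict y x].

Definition well_ordered (A : set T) : Prop :=
  linearly_ordered A /\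
  forall B : set T, B `<=` A -> B !=set0 ->
    exists2 b, B b & forall x, B x -> le b x.

Definition is_sup (A : set T) (s : T) : Prop :=
  (forall x, A x -> le x s) /\
  (forall u, (forall x, A x -> le x u) -> le s u).

End Relations.

(* No associativity or commutativity.  Paper terminology: "left distributive"
   is a(b+c) = ab+ac, which ssrfun calls right_distributive. *)
Record quasiring := Quasiring {
  qcar :> Type;
  qzero : qcar;
  qone : qcar;
  qadd : qcar -> qcar -> qcar;
  qmul : qcar -> qcar -> qcar;
  qadd0l : left_id qzero qadd;
  qadd0r : right_id qzero qadd;
  qone_neq0 : qone <> qzero;
  qmul_neq0 : forall a b, a <> qzero -> b <> qzero -> qmul a b <> qzero;
  qmul1l : forall a, a <> qzero -> qmul qone a = a;
  qmul1r : forall a, a <> qzero -> qmul a qone = a;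
  qmul0l : left_zero qzero qmul;
  qmul0r : right_zero qzero qmul;
  qdistr : right_distributive qmul qadd \/ left_distributive qmul qadd
}.

Record directed_quasiring := DirectedQuasiring {
  dq_quasiring :> quasiring;
  qle : dq_quasiring -> dq_quasiring -> Prop;
  qle_trans : forall x y z, qle x y -> qle y z -> qle x z;
  qle_refl : forall x, qle x x;
  qle_directed : forall x y, exists2 z, qle x z & qle y z;
  qle_op : forall (L : set dq_quasiring) a b c d, linearly_ordered qle L ->
    L a -> L b -> L c -> L d -> qle a c -> qle b d ->
    qle (qadd a b) (qadd c d) /\ qle (qmul a b) (qmul c d);
  qle0 : forall x, qle (qzero dq_quasiring) x
}.

Definition DW (K : directed_quasiring) : Prop :=
  forall A : set K, linearly_ordered (@qle K) A ->
    exists2 B, well_ordered (@qle K) B & A `<=` B.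

Definition left_distributive_quasiring (K : quasiring) : Prop :=
  right_distributive (@qmul K) (@qadd K).

Definition Ob_K (K : directed_quasiring) : Prop := DW K.
Definition Ob_Kw (K : directed_quasiring) : Prop :=
  Ob_K K /\ well_ordered (@qle K) [set: K].
Definition Ob_Kl (K : directed_quasiring) : Prop :=
  Ob_K K /\ left_distributive_quasiring K.
Definition Ob_Kwl (K : directed_quasiring) : Prop :=
  Ob_Kw K /\ left_distributive_quasiring K.

Section FunctionSpaces.
Variable K : directed_quasiring.

Section Pointwise.
Variable X : Type.

Definition fun_le (f h : X -> K) : Prop := forall x, qle (f x) (h x).
Definition fun_add (f h : X -> K) : X -> K := fun x => qadd (f x) (h x).
Definition fun_scale (b : K) (f : X -> K) : X -> K := fun x => qmul b (f x).

Definition sup_exists : Prop :=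
  forall f : X -> K, exists s, is_sup (@qle K) (range f) s.

Definition order_preserving (nu : (X -> K) -> K) : Prop :=
  forall f h, fun_le f h -> qle (nu f) (nu h).

Definition weakly_additive (nu : (X -> K) -> K) : Prop :=
  forall (h : X -> K) (c : K),
    nu (fun_add h (cst c)) = qadd (nu h) c /\
    nu (fun_add (cst c) h) = qadd c (nu h).

Definition left_homogeneous (nu : (X -> K) -> K) : Prop :=
  forall (b : K) (f : X -> K), nu (fun_scale b f) = qmul b (nu f).

Definition O : set ((X -> K) -> K) :=
  [set nu | order_preserving nu /\ weakly_additive nu].

Definition O_h : set ((X -> K) -> K) :=
  [set nu | O nu /\ left_homogeneous nu].

End Pointwise.

Definition O_map (X Y : Type) (f : X -> Y) (nu : (X -> K) -> K) :
  (Y -> K) -> K := fun g => nu (g \o f).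

Section Monotone.
Variables (d : Order.disp_t) (X : orderType d).

Record Cplus := MkCplus {
  cplus_fun :> X -> K;
  cplus_mono : forall x y : X, (x <= y)%O -> qle (cplus_fun x) (cplus_fun y)
}.

Definition sup_exists_l : Prop :=
  forall f : Cplus, exists s, is_sup (@qle K) (range f) s.

Definition order_preserving_l (nu : Cplus -> K) : Prop :=
  forall f h : Cplus, fun_le f h -> qle (nu f) (nu h).

(* When K is not linearly ordered, h + g^c, g^c + h and bf may fail to be
   non-decreasing; the identities are required whenever their left-hand side
   is defined, i.e. when the pointwise sum or product k belongs to C_+. *)
Definition weakly_additive_l (nu : Cplus -> K) : Prop :=
  forall (h k : Cplus) (c : K),
    (k =1 fun_add h (cst c) -> nu k = qadd (nu h) c) /\
    (k =1 fun_add (cst c) h -> nu k = qadd c (nu h)).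

Definition left_homogeneous_l (nu : Cplus -> K) : Prop :=
  forall (b : K) (f k : Cplus), k =1 fun_scale b f -> nu k = qmul b (nu f).

Definition O_l : set (Cplus -> K) :=
  [set nu | order_preserving_l nu /\ weakly_additive_l nu].

Definition O_lh : set (Cplus -> K) :=
  [set nu | O_l nu /\ left_homogeneous_l nu].

End Monotone.

Section MonotoneMap.
Variables (d d' : Order.disp_t) (X : orderType d) (Y : orderType d').
Variable f : {omorphism X -> Y}.

Lemma cplus_comp_mono (g : Cplus Y) (x y : X) :
  (x <= y)%O -> qle (g (f x)) (g (f y)).
Proof. by move=> xy; apply: cplus_mono; apply: Order.OrderMorphismTheory.omorph_le. Qed.

Definition cplus_comp (g : Cplus Y) : Cplus X := MkCplus (cplus_comp_mono g).

Definition O_l_map (nu : Cplus X -> K) : Cplus Y -> K :=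
  fun g => nu (cplus_comp g).

End MonotoneMap.
End FunctionSpaces.

Arguments O K X : clear implicits.
Arguments O_h K X : clear implicits.
Arguments O_l K {d} X.
Arguments O_lh K {d} X.
Arguments sup_exists K X : clear implicits.
Arguments sup_exists_l K {d} X.

Definition set_epi (X Y : Type) (f : X -> Y) : Prop :=
  forall (Z : Type) (g h : Y -> Z), g \o f =1 h \o f -> g =1 h.

Definition linord_epi (d d' : Order.disp_t) (X : orderType d)
    (Y : orderType d') (f : {omorphism X -> Y}) : Prop :=
  forall (d'' : Order.disp_t) (Z : orderType d'') (g h : {omorphism Y -> Z}),
    g \o f =1 h \o f -> g =1 h.

Definition surjective_map (S T : Type) (A : set S) (B : set T) (F : S -> T) :
  Prop := set_fun A B F /\ set_surj A B F.

(* Main.v *)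
Require Import Defs.
From mathcomp Require Import all_boot all_order.
From mathcomp Require Import boolp classical_sets functions.
From HB Require Import structures.

(** An epimorphism of sets, or of linearly ordered sets, is surjective, so the
    axiom of choice gives a section [s] with [f \o s = id]. Between linear
    orders such a section is automatically non-decreasing, hence again a
    morphism. Functors preserve split epimorphisms: since
    O(f) (O(s) nu) = O(f \o s) nu = nu, the functional O(s) nu is a preimage
    of nu under O(f), and it lies in the right set because O(s) preserves order
    preservation, weak additivity and left homogeneity, as does O of any
    morphism. The order and the arithmetic of [K] enter only through the
    pointwise definitions of these properties, so the argument is the same for
    all four functors. *)

Set Implicit Arguments.
Unset Strict Implicit.
Unset Printing Implicit Defensive.

Import Order.TTheory.

Local Open Scope classical_set_scope.

Lemma surjective_map_section (S T : Type) (A : set S) (B : set T)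
    (F : S -> T) (G : T -> S) :
  set_fun A B F -> set_fun B A G -> cancel G F -> surjective_map A B F.
Proof. by move=> FAB GBA GK; split=> // t Bt; exists (G t); [apply: GBA|]. Qed.

Lemma choice_section (X Y : Type) (f : X -> Y) :
  (forall y, exists x, f x = y) -> exists s : Y -> X, cancel s f.
Proof. by move=> /choice[s sK]; exists s. Qed.

(** The indicator of the range of [f] and the constant true predicate agree
    along [f], so an epimorphism cannot miss a point. *)
Lemma set_epi_surj (X Y : Type) (f : X -> Y) :
  set_epi f -> forall y, exists x, f x = y.
Proof.
move=> /(_ Prop (fun y => exists x, f x = y) (cst True)) epi y.
by rewrite epi // => x /=; apply/propext; split=> // _; exists x.
Qed.

Section Sets.
Variables (K : directed_quasiring) (X Y : Type) (f : X -> Y).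

Lemma O_map_fun : set_fun (O K X) (O K Y) (O_map f).
Proof.
move=> nu [nu_le nuD]; split=> [g h gh|h c]; last exact: (nuD (h \o f) c).
by apply: nu_le => x; apply: gh.
Qed.

Lemma O_h_map_fun : set_fun (O_h K X) (O_h K Y) (O_map f).
Proof.
move=> nu [nuO nuZ]; split; first exact: O_map_fun.
by move=> b g; apply: (nuZ b (g \o f)).
Qed.

Lemma O_map_cancel (s : Y -> X) : cancel s f ->
  cancel (@O_map K Y X s) (O_map f).
Proof.
by move=> sK nu; apply/funext => g; congr nu; apply/funext => y /=; rewrite sK.
Qed.

End Sets.

Section LinearOrders.
Variables (d d' : Order.disp_t) (X : orderType d) (Y : orderType d').

Section CutMorphisms.
Variable y0 : Y.

Let ge_cut (y : Y) : bool := (y0 <= y)%O.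
Let gt_cut (y : Y) : bool := (y0 < y)%O.

Fact ge_cut_le : {homo ge_cut : x y / (x <= y)%O}.
Proof. by move=> x y xy; rewrite leEbool /ge_cut; case: leP => // /le_trans ->. Qed.

Fact gt_cut_le : {homo gt_cut : x y / (x <= y)%O}.
Proof. by move=> x y xy; rewrite leEbool /gt_cut; case: ltP => // /lt_le_trans ->. Qed.

(** The two Dedekind cuts at [y0] are morphisms to the two-element chain that
    differ at [y0] only. *)
Lemma morphisms_differing_at : exists g h : {omorphism Y -> bool},
  g y0 != h y0 /\ forall y, y != y0 -> g y = h y.
Proof.
pose gM := Order.isOrderMorphism.Build _ _ _ _ ge_cut ge_cut_le.
pose hM := Order.isOrderMorphism.Build _ _ _ _ gt_cut gt_cut_le.
pose g : {omorphism Y -> bool} := HB.pack ge_cut gM.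
pose h : {omorphism Y -> bool} := HB.pack gt_cut hM.
exists g, h; rewrite /= /ge_cut /gt_cut lexx ltxx; split=> // y neq_y.
by rewrite lt_neqAle eq_sym neq_y.
Qed.

End CutMorphisms.

Lemma linord_epi_surj (f : {omorphism X -> Y}) :
  linord_epi f -> forall y, exists x, f x = y.
Proof.
move=> epi y0; apply: contrapT => y0_notin.
have [g [h [/eqP + eq_gh]]] := morphisms_differing_at y0; apply.
apply: epi => x /=; apply: eq_gh.
by apply/eqP => fx; apply: y0_notin; exists x.
Qed.

(** If [y <= y'] and [s y' <= s y], applying [f] gives [y' <= y], so [y = y'];
    as [X] is linear, the only other possibility is [s y <= s y']. *)
Lemma omorph_section_le (f : {omorphism X -> Y}) (s : Y -> X) :
  cancel s f -> {homo s : y y' / (y <= y')%O}.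
Proof.
move=> sK y y' yy'; have /orP[//|s_le] := le_total (s y) (s y').
have := Order.OrderMorphismTheory.omorph_le f s_le; rewrite !sK => y'y.
by have -> : y = y' by apply/le_anti; rewrite yy'.
Qed.

Lemma linord_epi_section (f : {omorphism X -> Y}) :
  linord_epi f -> exists s : {omorphism Y -> X}, cancel s f.
Proof.
move=> /linord_epi_surj/choice_section[s sK].
pose sM := Order.isOrderMorphism.Build _ _ _ _ s (omorph_section_le sK).
by exists (HB.pack s sM : {omorphism Y -> X}).
Qed.

End LinearOrders.

Lemma cplus_ext (K : directed_quasiring) (d : Order.disp_t) (X : orderType d)
    (g h : Cplus K X) : g =1 h -> g = h.
Proof.
case: g h => [g gM] [h hM] /= /funext gh.
by case: h / gh hM => hM; congr MkCplus; apply: Prop_irrelevance.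
Qed.

Section MonotoneFunctionals.
Variables (K : directed_quasiring) (d d' : Order.disp_t).
Variables (X : orderType d) (Y : orderType d') (f : {omorphism X -> Y}).

Lemma O_l_map_fun : set_fun (O_l K X) (O_l K Y) (O_l_map f).
Proof.
move=> nu [nu_le nuD]; split=> [g h gh|h k c].
  by apply: nu_le => x; apply: gh.
have [nuDr nuDl] := nuD (cplus_comp f h) (cplus_comp f k) c.
by split=> kE; [apply: nuDr|apply: nuDl] => x /=; rewrite kE.
Qed.

Lemma O_lh_map_fun : set_fun (O_lh K X) (O_lh K Y) (O_l_map f).
Proof.
move=> nu [nuO nuZ]; split; first exact: O_l_map_fun.
by move=> b g k kE; apply: nuZ => x /=; rewrite kE.
Qed.

Lemma O_l_map_cancel (s : {omorphism Y -> X}) : cancel s f ->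
  cancel (@O_l_map K _ _ Y X s) (O_l_map f).
Proof.
move=> sK nu; apply/funext => g; congr nu.
by apply: cplus_ext => y /=; rewrite sK.
Qed.

End MonotoneFunctionals.

Theorem proposition3p21 :
  (forall K : directed_quasiring, Ob_Kw K ->
     forall (X Y : Type) (f : X -> Y), sup_exists K X -> sup_exists K Y ->
     set_epi f -> surjective_map (O K X) (O K Y) (O_map f)) /\
  (forall K : directed_quasiring, Ob_Kwl K ->
     forall (X Y : Type) (f : X -> Y), sup_exists K X -> sup_exists K Y ->
     set_epi f -> surjective_map (O_h K X) (O_h K Y) (O_map f)) /\
  (forall K : directed_quasiring, Ob_K K ->
     forall (d d' : Order.disp_t) (X : orderType d) (Y : orderType d')
       (f : {omorphism X -> Y}), sup_exists_l K X -> sup_exists_l K Y ->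
     linord_epi f -> surjective_map (O_l K X) (O_l K Y) (O_l_map f)) /\
  (forall K : directed_quasiring, Ob_Kl K ->
     forall (d d' : Order.disp_t) (X : orderType d) (Y : orderType d')
       (f : {omorphism X -> Y}), sup_exists_l K X -> sup_exists_l K Y ->
     linord_epi f -> surjective_map (O_lh K X) (O_lh K Y) (O_l_map f)).
Proof.
split; [|split; [|split]].
- move=> K _ X Y f _ _ /set_epi_surj/choice_section[s sK].
  exact: surjective_map_section (@O_map_fun K _ _ f) (@O_map_fun K _ _ s)
    (O_map_cancel sK).
- move=> K _ X Y f _ _ /set_epi_surj/choice_section[s sK].
  exact: surjective_map_section (@O_h_map_fun K _ _ f) (@O_h_map_fun K _ _ s)
    (O_map_cancel sK).
- move=> K _ d d' X Y f _ _ /linord_epi_section[s sK].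
  exact: surjective_map_section (@O_l_map_fun K _ _ _ _ f)
    (@O_l_map_fun K _ _ _ _ s) (O_l_map_cancel sK).
- move=> K _ d d' X Y f _ _ /linord_epi_section[s sK].
  exact: surjective_map_section (@O_lh_map_fun K _ _ _ _ f)
    (@O_lh_map_fun K _ _ _ _ s) (O_l_map_cancel sK).
Qed.
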